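(* Let $H:\mathbb{R}^N\times\mathbb{R}^N\to\mathbb{R}$ be a continuous function satisfying the Standing Assumptions (SA) with constants $C_0,r,R,\alpha$. There is a constant $C>0$, depending only on $N,\alpha,r,R,C_0$, such that the following holds. Let $K\subset\mathbb{R}^N$ be closed, let $T>0$, and let $\bar x$ be a trajectory of the differential inclusion $x'(t)\in F(x(t))$, with $\bar x(0)\in K$, that is extremal on the time interval $[0,T]$. Then $\bar x$ is continuously differentiable on $[0,T]$ (with one-sided derivatives at the endpoints) and $$|\bar x'(t_2)-\bar x'(t_1)|\le C|t_2-t_1|^{\alpha/2}\qquad\forall t_1,t_2\in[0,T].$$
   Context: $\langle\cdot,\cdot\rangle$ and $|\cdot|$ are the Euclidean scalar product and norm on $\mathbb{R}^N$, $N\ge 1$. Standing Assumptions (SA), for positive constants $C_0,r,R$ with $r<R$ and $\alpha\in(0,1/2)$: (i) $|H(x,p)-H(y,p)|\le C_0|x-y|^{2\alpha}|p|$ for all $x,y,p\in\mathbb{R}^N$. (ii) For all $x$, the function $p\mapsto H(x,p)$ is convex on $\mathbb{R}^N$, positively homogeneous of degree one, and $r|p|\le H(x,p)\le R|p|$ for all $p\in\mathbb{R}^N$. (iii) For all $x$, $p\mapsto H(x,p)$ is continuously differentiable on $\mathbb{R}^N\setminus\{0\}$, with gradient in $p$ denoted $D_pH(x,p)$, and for all $p,q\in\mathbb{R}^N\setminus\{0\}$, $$-\frac{1}{2r}|D_pH(x,q)-D_pH(x,p)|^2\le\Big\langle D_pH(x,q)-D_pH(x,p),\frac{p}{|p|}\Big\rangle\le-\frac{1}{2R}|D_pH(x,q)-D_pH(x,p)|^2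 .$$ $F(x)=\mathrm{co}\{D_pH(x,p): p\in\mathbb{R}^N\setminus\{0\}\}$ (convex hull). A trajectory of $x'(t)\in F(x(t))$ is a locally absolutely continuous arc $x(\cdot):[0,\infty)\to\mathbb{R}^N$ satisfying the inclusion for a.e. $t\ge0$. Given a closed set $K\subset\mathbb{R}^N$, the reachable set (from $K$) in time $t\ge 0$ is $\mathcal{R}(t)=\{x(t): x(\cdot)\text{ is a trajectory with }x(0)\in K\}$. A trajectory $\bar x$ (starting in $K$) is called extremal on $[0,t]$ if $\bar x(t)\in\partial\mathcal{R}(t)$. *)

(* Defs.v *)
(* R^N is 'rV[R]_N; its library norm is the sup
   norm, so the Euclidean norm is introduced separately.  The two norms induce
   the same topology, hence limits, differentiability, open and closed sets
   are taken from the library. *)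
From HB Require Import structures.
From mathcomp Require Import all_boot all_order all_algebra.
From mathcomp Require Import all_classical all_reals all_analysis.

Set Implicit Arguments.
Unset Strict Implicit.
Unset Printing Implicit Defensive.

Import Order.TTheory GRing.Theory Num.Theory.
Import numFieldNormedType.Exports.

Local Open Scope classical_set_scope.
Local Open Scope ring_scope.

Definition dot (R : realType) (N : nat) (u v : 'rV[R]_N) : R :=
  \sum_(i < N) u 0 i * v 0 i.

Definition enorm (R : realType) (N : nat) (u : 'rV[R]_N) : R :=
  Num.sqrt (dot u u).

Definition convex_hull (R : realType) (E : lmodType R) (A : set E) : set E :=
  smallest (@convex_set R E) A.

Definition frontier (T : topologicalType) (A : set T) : set T :=
  closure A `\` interior A.

Definition grad (R : realType) (N : nat) (f : 'rV[R]_N -> R) (p : 'rV[R]_N) :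
    'rV[R]_N :=
  \row_(j < N) 'D_(delta_mx 0 j) f p.

Record standing_assumptions (R : realType) (N : nat) (C0 r Rup alpha : R)
    (H : 'rV[R]_N -> 'rV[R]_N -> R) : Prop := {
  SA_holder : forall x y p : 'rV[R]_N,
    `|H x p - H y p| <= C0 * enorm (x - y) `^ (2 * alpha) * enorm p;
  SA_convex : forall x, convex_function setT (H x);
  SA_homogeneous : forall (x p : 'rV[R]_N) (l : R),
    0 < l -> H x (l *: p) = l * H x p;
  SA_bounds : forall x p : 'rV[R]_N,
    r * enorm p <= H x p <= Rup * enorm p;
  SA_differentiable : forall x p : 'rV[R]_N,
    p != 0 -> differentiable (H x) p;
  SA_continuous_grad : forall x p : 'rV[R]_N,
    p != 0 -> {for p, continuous (grad (H x))};
  SA_monotone : forall x p q : 'rV[R]_N, p != 0 -> q != 0 ->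
    let d := grad (H x) q - grad (H x) p in
    - (2 * r)^-1 * enorm d ^+ 2
      <= dot d ((enorm p)^-1 *: p)
      <= - (2 * Rup)^-1 * enorm d ^+ 2
}.

Definition velocity_set (R : realType) (N : nat)
    (H : 'rV[R]_N -> 'rV[R]_N -> R) (x : 'rV[R]_N) : set 'rV[R]_N :=
  convex_hull [set grad (H x) p | p in [set p | p != 0]].

Definition absolutely_continuous_on (R : realType) (N : nat) (a b : R)
    (f : R -> 'rV[R]_N) : Prop :=
  forall e : R, 0 < e -> exists2 d : R, 0 < d &
    forall (n : nat) (u v : 'I_n -> R),
      (forall i, [/\ a <= u i, u i <= v i & v i <= b]) ->
      trivIset setT (fun i => `]u i, v i[%classic) ->
      \sum_(i < n) (v i - u i) < d ->
      \sum_(i < n) enorm (f (v i) - f (u i)) < e.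

(* An arc on [0, +oo[ is a total function on R whose values at negative times
   are irrelevant: they can only affect the derivative at t = 0, which is a
   null set. *)
Definition trajectory (R : realType) (N : nat)
    (H : 'rV[R]_N -> 'rV[R]_N -> R) (x : R -> 'rV[R]_N) : Prop :=
  (forall a b, 0 <= a -> a <= b -> absolutely_continuous_on a b x) /\
  {ae lebesgue_measure, forall t : R, 0 <= t ->
    derivable x t 1 /\ velocity_set H (x t) (derive1 x t)}.

Definition reachable (R : realType) (N : nat)
    (H : 'rV[R]_N -> 'rV[R]_N -> R) (K : set 'rV[R]_N) (t : R) :
    set 'rV[R]_N :=
  [set x t | x in [set x | trajectory H x /\ K (x 0)]].

Definition extremal (R : realType) (N : nat)
    (H : 'rV[R]_N -> 'rV[R]_N -> R) (K : set 'rV[R]_N) (t : R)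
    (x : R -> 'rV[R]_N) : Prop :=
  frontier (reachable H K t) (x t).

(* Derivative relative to A: two-sided at interior points of an interval A,
   one-sided at its endpoints. *)
Definition is_derivative_within (R : realType) (N : nat) (A : set R)
    (x : R -> 'rV[R]_N) (t : R) (v : 'rV[R]_N) : Prop :=
  (s - t)^-1 *: (x s - x t) @[s --> within A t^'] --> v.

(* Main.v *)
(** An extremal arc is a geodesic: since [F] contains the ball of radius [r],
    reaching [x T] ahead of time would put it in the interior of the reachable
    set, so no admissible curve joins two points of the arc faster than the arc
    itself.  Freeze the Hamiltonian at [x t1] on an interval of length [h]; the
    relative error is [kappa ^ 2], of order [h ^ (2 alpha)].  The velocities lie
    in [(1 + kappa ^ 2) F], while comparison with the straight segment shows
    that the mean velocity is not inside [(1 - kappa ^ 2) F].  By strict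
    convexity of [F] all averages of the velocity over subintervals of
    comparable length are then within [O(kappa) = O(h ^ alpha)] of each other,
    and such a control of the difference quotients at every scale yields a
    Hoelder continuous derivative.  The exponent [alpha / 2], smaller than
    [alpha], makes the estimate valid for large [h] as well. *)
Require Import Defs.
From HB Require Import structures.
From mathcomp Require Import all_boot all_order all_algebra.
From mathcomp Require Import all_classical all_reals all_analysis.
From mathcomp Require Import measurable_realfun ring lra.

Set Implicit Arguments.
Unset Strict Implicit.
Unset Printing Implicit Defensive.

Import Order.TTheory GRing.Theory Num.Theory.
Import numFieldNormedType.Exports.

Local Open Scope classical_set_scope.
Local Open Scope ring_scope.

(** * Euclidean structure *)

Section euclidean.
Context (R : realType) (N : nat).
Implicit Types (u v w p : 'rV[R]_N) (a b : R).

Lemma dotC u v : dot u v = dot v u.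
Proof. by apply: eq_bigr => i _; rewrite mulrC. Qed.

Lemma dotDr u v w : dot u (v + w) = dot u v + dot u w.
Proof. by rewrite -big_split /=; apply: eq_bigr => i _; rewrite mxE mulrDr. Qed.

Lemma dotZr a u v : dot u (a *: v) = a * dot u v.
Proof. by rewrite mulr_sumr; apply: eq_bigr => i _; rewrite mxE mulrCA. Qed.

Lemma dotNr u v : dot u (- v) = - dot u v.
Proof. by rewrite -scaleN1r dotZr mulN1r. Qed.

Lemma dotBr u v w : dot u (v - w) = dot u v - dot u w.
Proof. by rewrite dotDr dotNr. Qed.

Lemma dotDl u v w : dot (v + w) u = dot v u + dot w u.
Proof. by rewrite dotC dotDr !(dotC u). Qed.

Lemma dotZl a u v : dot (a *: v) u = a * dot v u.
Proof. by rewrite dotC dotZr dotC. Qed.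

Lemma dotNl u v : dot (- v) u = - dot v u.
Proof. by rewrite dotC dotNr dotC. Qed.

Lemma dotBl u v w : dot (v - w) u = dot v u - dot w u.
Proof. by rewrite dotDl dotNl. Qed.

Lemma dot0r u : dot u 0 = 0.
Proof. by rewrite -(scale0r 0) dotZr mul0r. Qed.

Lemma dot_ge0 u : 0 <= dot u u.
Proof. by apply: sumr_ge0 => i _; rewrite -expr2 sqr_ge0. Qed.

Lemma enorm_ge0 u : 0 <= enorm u.
Proof. exact: sqrtr_ge0. Qed.

Lemma enorm_sqr u : enorm u ^+ 2 = dot u u.
Proof. by rewrite sqr_sqrtr // dot_ge0. Qed.

Lemma enormZ a u : enorm (a *: u) = `|a| * enorm u.
Proof.
by rewrite /enorm dotZl dotZr mulrA -expr2 sqrtrM ?sqr_ge0 // sqrtr_sqr.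
Qed.

Lemma enormN u : enorm (- u) = enorm u.
Proof. by rewrite -scaleN1r enormZ normrN normr1 mul1r. Qed.

Lemma enormBC u v : enorm (u - v) = enorm (v - u).
Proof. by rewrite -enormN opprB. Qed.

Lemma enorm0 : enorm (0 : 'rV[R]_N) = 0.
Proof. by rewrite /enorm dot0r sqrtr0. Qed.

Lemma enorm_eq0 u : (enorm u == 0) = (u == 0).
Proof.
apply/idP/eqP => [|->]; last by rewrite enorm0.
rewrite sqrtr_eq0 => u0; apply/rowP => i; rewrite mxE.
have /eqP : dot u u = 0 by apply/eqP; rewrite eq_le u0 dot_ge0.
rewrite psumr_eq0 => [/allP/(_ i)|j _]; last by rewrite -expr2 sqr_ge0.
by rewrite mem_index_enum mulf_eq0 orbb => /(_ isT) /eqP.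
Qed.

Lemma enorm_gt0 u : (0 < enorm u) = (u != 0).
Proof. by rewrite lt_neqAle enorm_ge0 andbT eq_sym enorm_eq0. Qed.

(** Cauchy-Schwarz: expand the square of [enorm v *: u - enorm u *: v] and divide by
    [enorm u * enorm v]. *)
Lemma dot_le u v : dot u v <= enorm u * enorm v.
Proof.
have [->|v0] := eqVneq v 0; first by rewrite dot0r enorm0 mulr0.
have [->|u0] := eqVneq u 0; first by rewrite dotC dot0r enorm0 mul0r.
have := dot_ge0 (enorm v *: u - enorm u *: v).
rewrite dotBl !dotBr !dotZl !dotZr (dotC v u) -!enorm_sqr.
rewrite -enorm_gt0 in u0; rewrite -enorm_gt0 in v0.
have : 0 < enorm u * enorm v by exact: mulr_gt0.
nra.
Qed.

Lemma enormD u v : enorm (u + v) <= enorm u + enorm v.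
Proof.
rewrite -(@ler_pXn2r _ 2) ?nnegrE ?addr_ge0 ?enorm_ge0 //.
rewrite enorm_sqr dotDl !dotDr (dotC v u) -!enorm_sqr.
have := dot_le u v; nra.
Qed.

Lemma enormB_trans v u w : enorm (u - w) <= enorm (u - v) + enorm (v - w).
Proof. by have := enormD (u - v) (v - w); rewrite addrA subrK. Qed.

Lemma coord_le_enorm u i : `|u 0 i| <= enorm u.
Proof.
rewrite -sqrtr_sqr ler_sqrt ?dot_ge0 // /dot (bigD1 i) //= -expr2 lerDl.
by apply: sumr_ge0 => j _; rewrite -expr2 sqr_ge0.
Qed.

Lemma norm_le_enorm u : `|u| <= enorm u.
Proof.
rewrite [`|u|]mx_normrE; apply/bigmax_leP; split; first exact: enorm_ge0.
by move=> [i j] _ /=; rewrite (ord1 i) coord_le_enorm.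
Qed.

Lemma coord_le_norm u i : `|u 0 i| <= `|u|.
Proof.
rewrite [`|u|]mx_normrE.
by apply: (@le_bigmax_cond _ _ _ _ (0, i) xpredT (fun ij => `|u ij.1 ij.2|)).
Qed.

Lemma enorm_le_norm u : enorm u <= N%:R * `|u|.
Proof.
have N0 : 0 <= N%:R * `|u| by rewrite mulr_ge0.
rewrite -[leRHS]ger0_norm // -sqrtr_sqr ler_sqrt ?sqr_ge0 //.
rewrite (@le_trans _ _ (\sum_(i < N) `|u| ^+ 2)) //.
  apply: ler_sum => i _; rewrite -expr2 -real_normK ?num_real //.
  by rewrite ler_sqr ?nnegrE // coord_le_norm.
rewrite sumr_const card_ord -[_ *+ N]mulr_natl exprMn ler_wpM2r ?sqr_ge0 //.
by rewrite -natrX ler_nat; case: (N) => // n; rewrite expnS leq_pmulr ?expn1.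
Qed.

Lemma dist_enorm_le u v : `|enorm u - enorm v| <= enorm (u - v).
Proof.
have := enormB_trans v u 0; have := enormB_trans u v 0.
by rewrite !subr0 (enormBC v u) ler_norml => *; apply/andP; split; lra.
Qed.

Lemma dist_dot_le p u v : `|dot p u - dot p v| <= enorm p * enorm (u - v).
Proof.
rewrite -dotBr ler_norml dot_le andbT lerNl -dotNr opprB enormBC.
exact: dot_le.
Qed.

Lemma lipschitz_enorm_continuous (f : 'rV[R]_N -> R) M :
  (forall u v, `|f u - f v| <= M * enorm (u - v)) -> continuous f.
Proof.
move=> fM u; apply/(@cvgrPdist_le _ _ _ (nbhs u)) => e e0.
set L := `|M| * N%:R + 1.
have L0 : 0 < L by rewrite ltr_wpDl ?mulr_ge0.
have d0 : 0 < e / L by rewrite divr_gt0.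
near=> v; apply: (le_trans (fM u v)).
rewrite (@le_trans _ _ (L * `|u - v|)) //.
  rewrite (@le_trans _ _ (`|M| * enorm (u - v))) //.
    by rewrite ler_wpM2r ?enorm_ge0 ?ler_norm.
  rewrite (@le_trans _ _ (`|M| * (N%:R * `|u - v|))) //.
    by rewrite ler_wpM2l ?enorm_le_norm.
  by rewrite mulrA ler_wpM2r // lerDl.
rewrite -ler_pdivlMl // mulrC; near: v.
by apply: (@cvgr_dist_le _ _ _ (nbhs u) _ id).
Unshelve. all: by end_near. Qed.

Lemma continuous_enorm : continuous (@enorm R N).
Proof.
by apply: (@lipschitz_enorm_continuous _ 1) => u v; rewrite mul1r dist_enorm_le.
Qed.

Lemma continuous_dot u : continuous (dot u).
Proof. by apply: lipschitz_enorm_continuous => v w; exact: dist_dot_le. Qed.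

End euclidean.

(** * Velocity sets and their support functions *)

Section convexity.
Context (R : realType) (E : lmodType R).
Implicit Types (A : set E) (a b : E).

Lemma convex_setP A :
  @convex_set R E A <->
  (forall a b t, 0 <= t -> t <= 1 -> A a -> A b -> A (t *: a + (1 - t) *: b)).
Proof.
split=> [cA a b t t0 t1 Aa Ab|cA a b t /set_mem Aa /set_mem Ab].
  exact: set_mem (cA a b (Itv01 t0 t1) (mem_set Aa) (mem_set Ab)).
by apply/mem_set/cA.
Qed.

Lemma convex_hull_convex A : @convex_set R E (convex_hull A).
Proof.
apply/convex_setP => a b t t0 t1 Aa Ab B [cB AB].
by apply: (iffLR (convex_setP B) cB) => //; [exact: Aa|exact: Ab].
Qed.

Lemma sub_convex_hull A : A `<=` convex_hull A.
Proof. by move=> a Aa B [_]; exact. Qed.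

End convexity.

(** * One-sided estimates of directional derivatives *)

Section directional_derivative.
Context (R : realType) (N : nat).
Implicit Types (f : 'rV[R]_N -> R) (p q v : 'rV[R]_N).

Lemma derive_dot_grad f p q : differentiable f p -> 'D_q f p = dot (grad f p) q.
Proof.
move=> df; rewrite deriveE // {1}(row_sum_delta q) linear_sum /=.
by apply: eq_bigr => i _; rewrite linearZ /= mxE deriveE // mulrC.
Qed.

(** Since the derivative exists, it is the limit from the right, so small positive [t] suffice. *)
Lemma derive_le f p q c : differentiable f p ->
  (forall t, 0 < t -> t < 1 -> f (p + t *: q) - f p <= t * c) -> 'D_q f p <= c.
Proof.
move=> df H; have cf : derivable f p q by exact: diff_derivable.
rewrite /derive cvg_at_rightE //.
apply: (@limr_le _ (0^'+) _ R c (fun t => t^-1 *: ((f \o shift p) (t *: q) - f p))).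
  move: cf => /cvg_ex[l fl]; apply/cvg_ex; exists l.
  exact: cvg_dnbhs_at_right.
near=> t; rewrite /= [t *: q + p]addrC.
have t0 : 0 < t by near: t; exact: nbhs_right_gt.
by rewrite [_ *: _]mulrC ler_pdivrMr // mulrC H //; near: t; exact: nbhs_right_lt.
Unshelve. all: by end_near. Qed.

Lemma derive_ge f p q c : differentiable f p ->
  (forall t, 0 < t -> t < 1 -> t * c <= f (p + t *: q) - f p) -> c <= 'D_q f p.
Proof.
move=> df H; rewrite -lerN2 -deriveN; last exact: diff_derivable.
apply: derive_le => [|t t0 t1]; first exact: differentiableN.
by rewrite -opprD mulrN lerN2 H.
Qed.

End directional_derivative.

(** * Duality between the Hamiltonian and the velocity set *)

Section velocity.
Context (R : realType) (N : nat) (C0 r Rup alpha : R).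
Context (r_gt0 : 0 < r) (r_lt_Rup : r < Rup).
Context (H : 'rV[R]_N -> 'rV[R]_N -> R).
Context (SA : standing_assumptions C0 r Rup alpha H).
Implicit Types (x p q v w : 'rV[R]_N).

Let Rup_gt0 : 0 < Rup. Proof. exact: lt_trans r_lt_Rup. Qed.

Lemma hamiltonian_ge x p : r * enorm p <= H x p.
Proof. by have /andP[] := SA_bounds SA x p. Qed.

Lemma hamiltonian_le x p : H x p <= Rup * enorm p.
Proof. by have /andP[] := SA_bounds SA x p. Qed.

Lemma hamiltonian_ge0 x p : 0 <= H x p.
Proof.
by apply: le_trans (hamiltonian_ge x p); rewrite mulr_ge0 ?enorm_ge0 // ltW.
Qed.

Lemma hamiltonian_gt0 x p : p != 0 -> 0 < H x p.
Proof.
by move=> p0; apply: lt_le_trans (hamiltonian_ge x p); rewrite mulr_gt0 ?enorm_gt0.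
Qed.

Lemma hamiltonian0 x : H x 0 = 0.
Proof.
apply/le_anti; rewrite hamiltonian_ge0 (le_trans (hamiltonian_le _ _)) //.
by rewrite enorm0 mulr0.
Qed.

Lemma hamiltonianD x p q : H x (p + q) <= H x p + H x q.
Proof.
have h2 : (0 : R) <= 2^-1 by rewrite invr_ge0.
have h1 : (2^-1 : R) <= 1 by rewrite invf_le1 // ler1n.
have : H x (2^-1 *: (2 *: p) + (1 - 2^-1) *: (2 *: q))
    <= 2^-1 * H x (2 *: p) + (1 - 2^-1) * H x (2 *: q).
  exact: (SA_convex SA x (Itv01 h2 h1) (@mem_set _ setT (2 *: p) I)
    (@mem_set _ setT (2 *: q) I)).
have -> : 1 - 2^-1 = 2^-1 :> R by lra.
rewrite !(SA_homogeneous SA) // !scalerA !mulrA mulVf ?pnatr_eq0 //.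
by rewrite !scale1r !mul1r.
Qed.

Lemma dot_grad_le x p q : p != 0 -> dot (grad (H x) p) q <= H x q.
Proof.
move=> p0; have dH := SA_differentiable SA x p0.
rewrite -derive_dot_grad //; apply: derive_le => // t t0.
by rewrite lerBlDl -(SA_homogeneous SA) // hamiltonianD.
Qed.

(** Euler's identity. The inequality not covered by [dot_grad_le] comes from differentiating along
    [- p], where homogeneity gives [H x] explicitly. *)
Lemma dot_grad_self x p : p != 0 -> dot (grad (H x) p) p = H x p.
Proof.
move=> p0; apply/le_anti; rewrite dot_grad_le //=.
have dH := SA_differentiable SA x p0.
rewrite -lerN2 -dotNr -derive_dot_grad //; apply: derive_le => // t t0 t1.
have -> : p + t *: - p = (1 - t) *: p by rewrite scalerBl scale1r scalerN.
by rewrite (SA_homogeneous SA) ?subr_gt0 //; lra.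
Qed.

(** The function [H x q - dot q v] of [q] is nonnegative and vanishes at [p], so its derivative
    there is nonnegative in every direction, in particular along [v - grad (H x) p]. *)
Lemma eq_grad x p v : p != 0 -> dot p v = H x p ->
  (forall q, dot q v <= H x q) -> grad (H x) p = v.
Proof.
move=> p0 pv vle; have dH := SA_differentiable SA x p0.
have Dge q : dot v q <= dot (grad (H x) p) q.
  rewrite dotC -derive_dot_grad //; apply: derive_ge => // t t0 _.
  by have := vle (p + t *: q); rewrite dotDl dotZl pv; lra.
apply/eqP; rewrite eq_sym -subr_eq0 -enorm_eq0 -sqrf_eq0 enorm_sqr.
by rewrite eq_le dot_ge0 dotBl subr_le0 Dge.
Qed.

Lemma velocity_dot_le x v : velocity_set H x v -> forall q, dot q v <= H x q.
Proof.
move=> vx q; apply: (vx [set w | dot q w <= H x q]); split.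
  apply/convex_setP => a b t t0 t1 /= aq bq.
  by rewrite dotDr !dotZr; nra.
by move=> _ [p /= p0 <-]; rewrite dotC dot_grad_le.
Qed.

(** For gradients this is the right half of [SA_monotone]. It describes a sublevel set of a convex
    function of [v], so it passes to the convex hull. *)
Lemma velocity_strict_convexity x p v : p != 0 -> velocity_set H x v ->
  dot p (v - grad (H x) p)
    <= - (2 * Rup)^-1 * enorm (v - grad (H x) p) ^+ 2 * enorm p.
Proof.
move=> p0 vx; set g := grad (H x) p.
apply: (vx [set v | dot p (v - g)
  <= - (2 * Rup)^-1 * enorm (v - g) ^+ 2 * enorm p]); split.
  apply/convex_setP => a b t t0 t1 /= ap bp.
  have -> : t *: a + (1 - t) *: b - g = t *: (a - g) + (1 - t) *: (b - g).
    by rewrite !scalerBr addrACA -opprD -scalerDl subrKC scale1r.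
  move: (a - g) (b - g) ap bp => A B ap bp.
  have e2 : enorm (t *: A + (1 - t) *: B) ^+ 2
      <= t * enorm A ^+ 2 + (1 - t) * enorm B ^+ 2.
    rewrite enorm_sqr dotDl !dotDr !dotZl !dotZr (dotC B A) -!enorm_sqr.
    have := dot_ge0 (A - B); rewrite dotBl !dotBr (dotC B A) -!enorm_sqr => AB.
    have : 0 <= t * (1 - t) by rewrite mulr_ge0 // subr_ge0.
    nra.
  rewrite dotDr !dotZr.
  have c0 : 0 <= (2 * Rup)^-1 * enorm p.
    by rewrite mulr_ge0 ?enorm_ge0 // invr_ge0 mulr_ge0 // ltW.
  have := ler_wpM2l c0 e2.
  have : 0 <= 1 - t by rewrite subr_ge0.
  nra.
move=> _ [q /= q0 <-]; have /andP[_] := SA_monotone SA x p0 q0.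
by rewrite dotZr dotC mulrC ler_pdivrMr ?enorm_gt0.
Qed.

Let compact_sphere : compact [set p : 'rV[R]_N | enorm p = 1].
Proof.
apply: bounded_closed_compact.
  exists 1; split => // M M1 p /= p1.
  by rewrite (le_trans (norm_le_enorm p)) // p1 ltW.
by apply: closed_comp (@closed_eq _ 1) => p _; exact: continuous_enorm.
Qed.

(** Maximise [dot p v / H x p] over the unit sphere. The maximum [g] is the gauge of [v] for the
    convex set with support function [H x], and a maximiser [p] is an outer normal. *)
Lemma gauge_exists x v : v != 0 -> exists g p,
  [/\ 0 < g, enorm p = 1, dot p v = g * H x p & forall q, dot q v <= g * H x q].
Proof.
move=> v0; set S := [set p : 'rV[R]_N | enorm p = 1].
have Sn0 (p : 'rV[R]_N) : S p -> p != 0.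
  by move=> /= p1; rewrite -enorm_eq0 p1 oner_eq0.
have SZ (p : 'rV[R]_N) : p != 0 -> S ((enorm p)^-1 *: p).
  move=> p0; rewrite /S /= enormZ ger0_norm ?invr_ge0 ?enorm_ge0 //.
  by rewrite mulVf // enorm_eq0.
have S0 : S !=set0 by exists ((enorm v)^-1 *: v); exact: SZ.
have cd : continuous (fun p : 'rV[R]_N => dot p v).
  rewrite (_ : (fun p => _) = dot v); first exact: continuous_dot.
  by apply/funext => p; rewrite dotC.
have cS : {within S, continuous (fun p => dot p v / H x p)}.
  apply: continuous_in_subspaceT => p /set_mem Sp; apply: (continuousM (cd p)).
  apply: continuousV; first by rewrite gt_eqF // hamiltonian_gt0 // Sn0.
  exact/differentiable_continuous/(SA_differentiable SA)/Sn0.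
have [p /set_mem Sp pmax] := EVT_max_rV S0 compact_sphere cS.
have gmax q : dot q v <= dot p v / H x p * H x q.
  have [->|q0] := eqVneq q 0; first by rewrite dotC dot0r hamiltonian0 mulr0.
  rewrite -ler_pdivrMr ?hamiltonian_gt0 //.
  have := pmax _ (mem_set (SZ _ q0)).
  have q1 : 0 < (enorm q)^-1 by rewrite invr_gt0 enorm_gt0.
  by rewrite dotZl (SA_homogeneous SA) // invfM mulrACA divff ?mul1r // gt_eqF.
exists (dot p v / H x p), p; split => //.
  have := gmax v; have : 0 < dot v v by rewrite -enorm_sqr exprn_gt0 ?enorm_gt0.
  move=> vv /(lt_le_trans vv); rewrite pmulr_lgt0 // hamiltonian_gt0 //.
by rewrite divfK // gt_eqF // hamiltonian_gt0 // Sn0.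
Qed.

(** In the direction [p], the point [g^-1 *: v] attains the support function, so [eq_grad]
    identifies it with a gradient. *)
Lemma velocity_gauge x v : v != 0 -> exists g p,
  [/\ 0 < g, enorm p = 1, dot p v = g * H x p, v = g *: grad (H x) p &
      velocity_set H x (g^-1 *: v)].
Proof.
move=> /(gauge_exists x)[g [p [g0 p1 pv gmax]]]; exists g, p.
have p0 : p != 0 by rewrite -enorm_eq0 p1 oner_eq0.
have gradp : grad (H x) p = g^-1 *: v.
  apply: eq_grad => // [|q]; first by rewrite dotZr pv mulKf // gt_eqF.
  by rewrite dotZr ler_pdivrMl.
split=> //; first by rewrite gradp scalerA divff ?scale1r // gt_eqF.
by apply: sub_convex_hull; exists p.
Qed.

(* No closure of the hull is needed: boundary points of the set on the right
   are gradients, and an inner point lies on a segment between two of them. *)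
Lemma velocityP (N_gt0 : (0 < N)%N) x v :
  velocity_set H x v <-> forall q, dot q v <= H x q.
Proof.
split=> [|vle]; first exact: velocity_dot_le.
have cF := iffLR (convex_setP _) (@convex_hull_convex _ _
  [set grad (H x) p | p in [set p | p != 0]]).
(* The velocity set contains [g^-1] times the all-ones vector and [k^-1] times its opposite; the
   weight [g / (g + k)] makes them cancel. *)
have F0 : velocity_set H x 0.
  have e0 : const_mx 1 != 0 :> 'rV[R]_N.
    apply/eqP => /rowP /(_ (Ordinal N_gt0)); rewrite !mxE => /eqP.
    by rewrite oner_eq0.
  have [g [_ [g0 _ _ _ Fg]]] := velocity_gauge x e0.
  have [k [_ [k0 _ _ _ Fk]]] : exists g p, [/\ 0 < g, enorm p = 1,
      dot p (- const_mx 1) = g * H x p, - const_mx 1 = g *: grad (H x) p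
    & velocity_set H x (g^-1 *: - const_mx 1)].
    by apply: velocity_gauge; rewrite oppr_eq0.
  have gk : 0 < g + k by rewrite addr_gt0.
  have := cF _ _ (g / (g + k)) _ _ Fg Fk.
  rewrite !scalerA scalerN (_ : (1 - g / (g + k)) / k = g / (g + k) / g).
    by rewrite subrr; apply; rewrite ?ler_pdivrMr ?mul1r ?lerDl ?divr_ge0 // ltW.
  by field; rewrite !gt_eqF.
have [->//|v0] := eqVneq v 0.
have [g [p [g0 p1 pv _ Fv]]] := velocity_gauge x v0.
have g1 : g <= 1.
  rewrite -(ler_pM2r (hamiltonian_gt0 x (p := p) _)) ?mul1r -?pv //.
  by rewrite -enorm_eq0 p1 oner_eq0.
have := cF _ _ g (ltW g0) g1 Fv F0.
by rewrite scaler0 addr0 scalerA divff ?scale1r // gt_eqF.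
Qed.

Lemma velocity_enorm_le x v : velocity_set H x v -> enorm v <= Rup.
Proof.
move=> /velocity_dot_le /(_ v); rewrite -enorm_sqr => vv.
have [->|v0] := eqVneq v 0; first by rewrite enorm0 ltW.
by move: (le_trans vv (hamiltonian_le x v)); rewrite ler_pM2r ?enorm_gt0.
Qed.

End velocity.

(** * Absolutely continuous arcs *)

Section absolute_continuity.
Context (R : realType) (N : nat).
Implicit Types (x : R -> 'rV[R]_N) (p : 'rV[R]_N) (a b c e s t : R).

(** Splitting at [t] extends the bound from quotients based at [t] to all short intervals containing
    [t], which is what a real induction needs. *)
Lemma derive_straddle x p t c e : derivable x t 1 -> dot p (derive1 x t) <= c ->
  0 < e -> exists2 d, 0 < d &
    forall s w, t - d < s -> s <= t -> t <= w -> w < t + d ->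
    dot p (x w - x s) <= (c + e) * (w - s).
Proof.
move=> dx xc e0.
have : dot p (h^-1 *: ((x \o shift t) (h *: 1) - x t)) @[h --> 0^'] -->
    dot p (derive1 x t).
  by apply: continuous_cvg; [exact: continuous_dot|rewrite derive1E].
move=> /cvgr_lt /(_ (c + e)) /(_ (le_lt_trans xc _)).
rewrite ltrDl => /(_ e0) [d /= d0 dP].
have dN h : h != 0 -> `|h| < d -> dot p (x (h + t) - x t) / h < c + e.
  move=> h0 hd; have := dP h; rewrite /= sub0r normrN => /(_ hd h0).
  by rewrite dotZr mulrC scaler1.
exists d => // s w ds st tw wd.
have ws : dot p (x w - x t) <= (c + e) * (w - t).
  have [->|wt] := eqVneq w t; first by rewrite !subrr mulr0 dot0r.
  have wt0 : 0 < w - t by rewrite subr_gt0 lt_neqAle eq_sym wt.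
  rewrite -ler_pdivrMr //; apply/ltW.
  have := dN (w - t); rewrite subrK; apply; first by rewrite gt_eqF.
  by rewrite gtr0_norm //; lra.
have ts : dot p (x t - x s) <= (c + e) * (t - s).
  have [->|ts] := eqVneq s t; first by rewrite !subrr mulr0 dot0r.
  have ts0 : 0 < t - s by rewrite subr_gt0 lt_neqAle ts.
  rewrite -ler_pdivrMr //; apply/ltW.
  have := dN (s - t); rewrite subrK -(opprB t s) -(opprB (x t)) dotNr invrN mulrNN.
  apply; first by rewrite oppr_eq0 gt_eqF.
  by rewrite normrN gtr0_norm //; lra.
have -> : x w - x s = (x w - x t) + (x t - x s) by rewrite addrA subrK.
by rewrite dotDr; lra.
Qed.

(* The intervals are listed from right to left. *)
Definition interval_family a s (L : seq (R * R)) :=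
  [/\ all (fun uv => [&& a <= uv.1, uv.1 <= uv.2 & uv.2 <= s]) L &
      pairwise (fun uv uv' => uv'.2 <= uv.1) L].

(** Lists can be extended by one interval at a time during an induction; their order yields the
    disjointness required by the definition. *)
Lemma absolutely_continuous_seq x a b e : absolutely_continuous_on a b x -> 0 < e ->
  exists2 d, 0 < d & forall L, interval_family a b L ->
    \sum_(uv <- L) (uv.2 - uv.1) < d ->
    \sum_(uv <- L) enorm (x uv.2 - x uv.1) < e.
Proof.
move=> xac /xac[d d0 dP]; exists d => // L [/allP La Lp] Ld.
pose u (i : 'I_(size L)) := (tnth (in_tuple L) i).1.
pose v (i : 'I_(size L)) := (tnth (in_tuple L) i).2.
have sumE (F : R * R -> R) : \sum_(uv <- L) F uv = \sum_(i < size L) F (u i, v i).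
  rewrite (big_tnth _ _ L) /=; apply: eq_bigr => i _.
  by rewrite -surjective_pairing.
rewrite (sumE (fun uv => enorm (x uv.2 - x uv.1))).
rewrite (sumE (fun uv => uv.2 - uv.1)) in Ld.
apply: (dP (size L) u v) => [i|i j _ _ ne|//].
  by have /and3P := La _ (mem_tnth i (in_tuple L)).
apply/val_inj/eqP/negPn/negP => ij.
wlog lij : i j ne ij / (i < j)%N.
  move=> W; move: (ij); rewrite neq_ltn => /orP[|ji]; first exact: W.
  by apply: (W j i) => //; [rewrite setIC|rewrite eq_sym].
have := pairwiseP (0, 0) Lp; rewrite /prop_in2 /=.
move=> /(_ i j); rewrite !inE => /(_ (ltn_ord i) (ltn_ord j) lij).
have [z [/=]] := ne; rewrite !in_itv /= => /andP[h1 h2] /andP[h3 h4].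
rewrite /u /v !(tnth_nth (0, 0)) /= in h1 h2 h3 h4.
by move=> h; have := lt_le_trans h4 h; lra.
Qed.

(** Outer regularity, applied to a measurable null superset of [A]. *)
Lemma negligible_open_cover (A : set R) e :
  lebesgue_measure.-negligible A -> 0 < e ->
  exists U : set R, [/\ open U, A `<=` U & (lebesgue_measure U < e%:E)%E].
Proof.
move=> [B [mB B0 AB]] e0.
have B0' : lebesgue_measure (B : set R) = 0%E := B0.
have Bfin : (lebesgue_measure (B : set R) < +oo)%E by rewrite B0' ltry.
have [U [oU BU Ud]] := lebesgue_regularity_outer mB Bfin e0.
have mU : measurable U by exact: open_measurable.
exists U; split=> //; first exact: subset_trans BU.
apply: le_lt_trans Ud; rewrite -[X in lebesgue_measure X](setDUK BU).
apply: (le_trans (measureU2 _ _ _)) => //=; first exact: measurableD.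
by rewrite [X in (X + _)%E]B0' add0e.
Qed.

(* Real induction on [s]: from [a] to [s], the increment is controlled by the
   derivative bound, up to intervals contained in a small open neighbourhood
   of the exceptional null set. *)
Lemma dot_increment_le_off_null x p a b c : a <= b -> 0 <= c ->
  absolutely_continuous_on a b x ->
  {ae lebesgue_measure, forall t, a <= t <= b ->
    derivable x t 1 /\ dot p (derive1 x t) <= c} ->
  dot p (x b - x a) <= c * (b - a).
Proof.
set D := fun t => a <= t <= b -> _; move=> ab c0 xac N0.
suff core e : 0 < e -> dot p (x b - x a) <= (c + e) * (b - a) + enorm p * e.
  apply/ler_addgt0Pr => e e0; set M := b - a + enorm p + 1.
  have M0 : 0 < M by have := enorm_ge0 p; rewrite /M; lra.
  apply: le_trans (core (e / M) (divr_gt0 e0 M0)) _.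
  have := divr_gt0 e0 M0; have : e / M * M = e by rewrite divfK // gt_eqF.
  by move: (e / M) => q; rewrite /M; nra.
move=> e0; have [d d0 dP] := absolutely_continuous_seq xac e0.
have [U [oU BU Ud]] := negligible_open_cover N0 d0.
have mU : measurable U by exact: open_measurable.
(* Invariant of the induction: [L] collects intervals around exceptional times, and their total
   length is paid for by the measure of [U] to the left of [s]. *)
pose P s := [/\ a <= s, s <= b & exists2 L, interval_family a s L &
  ((\sum_(uv <- L) (uv.2 - uv.1))%:E <= lebesgue_measure (U `&` `]a, s[))%E /\
  dot p (x s - x a) <= (c + e) * (s - a)
    + enorm p * \sum_(uv <- L) enorm (x uv.2 - x uv.1)].
have Pa : P a.
  split=> //; exists [::]; first by [].
  by rewrite !big_nil subrr dot0r !mulr0 subrr mulr0 addr0 measure_ge0.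
have step t : a <= t <= b -> exists2 h, 0 < h & forall s w,
    t - h < s -> s <= t -> t <= w -> w < t + h -> w <= b -> P s -> P w.
  (* If the derivative bound fails at [t], then [t] lies in [U] and [(s, w)] joins the list;
     otherwise the straddle estimate applies and the list is kept. *)
  move=> /andP[at_ tb]; have [Dt|Bt] := pselect (D t); last first.
    have /nbhs_ballP[h /= h0 hU] : nbhs t U.
      by apply: open_nbhs_nbhs; split=> //; exact: BU.
    exists h => // s w hs st tw wh wb [as_ sb [L [/allP La Lp] [Lm Lx]]].
    have sw := le_trans st tw.
    split=> //; first exact: le_trans sw.
    exists ((s, w) :: L).
      split=> /=; rewrite ?as_ ?sw ?lexx /=.
        by apply/allP => uv /La /and3P[-> -> /= h1]; exact: le_trans sw.
      by rewrite Lp andbT; apply/allP => uv /La /and3P[].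
    rewrite !big_cons /=; split; last first.
      have -> : x w - x a = (x w - x s) + (x s - x a) by rewrite addrA subrK.
      by rewrite dotDr; have := dot_le p (x w - x s); nra.
    have sub : `]s, w[ `<=` U.
      move=> z; rewrite /= in_itv /= => /andP[sz zw]; apply: hU.
      by rewrite /ball /= ltr_norml; lra.
    have sE : (lebesgue_measure `]s, w[ = (w - s)%:E)%E.
      rewrite lebesgue_measure_itv /= lte_fin; case: ltP => //= ws.
      have -> : w = s by apply/eqP; rewrite eq_le ws sw.
      by rewrite subrr.
    have mUi (i : interval R) : measurable (U `&` [set` i]).
      by apply: measurableI => //; exact: measurable_itv.
    have le2 : (lebesgue_measure ((U `&` `]a, s[) `|` `]s, w[) <=
        lebesgue_measure (U `&` `]a, w[))%E.
      apply: le_measure; rewrite ?inE; [|exact: mUi|].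
        by apply: measurableU; [exact: mUi|].
      move=> z [[Uz]|]; rewrite /= !in_itv /= => /andP[h1 h2].
        by split=> //; rewrite h1 /= (lt_le_trans h2).
      split; first by apply: sub; rewrite /= in_itv /= h1.
      by rewrite h2 (le_lt_trans as_).
    apply: le_trans le2;
    rewrite measureU; [|exact: mUi|exact: measurable_itv|]; last first.
      rewrite -subset0 => z [[_]] /=; rewrite !in_itv /= => /andP[_ h1] /andP[h2 _].
      by have := lt_trans h1 h2; rewrite ltxx.
    by rewrite EFinD addeC [X in (_ <= _ + X)%E]sE leeD2r.
  have [|dx xc] := Dt; first by rewrite at_.
  have [h h0 hP] := derive_straddle dx xc e0.
  exists h => // s w hs st tw wh wb [as_ sb [L [/allP La Lp] [Lm Lx]]].
  have sw := le_trans st tw.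
  split=> //; first exact: le_trans sw.
  exists L.
    by split => //; apply/allP => uv /La /and3P[-> -> /= h1]; exact: le_trans sw.
  split.
    apply: (le_trans Lm); apply: le_measure; rewrite ?inE //;
      try by apply: measurableI => //; exact: measurable_itv.
    move=> z [Uz] /=; rewrite !in_itv /= => /andP[-> h2]; split => //.
    exact: lt_le_trans sw.
  have -> : x w - x a = (x w - x s) + (x s - x a) by rewrite addrA subrK.
  by rewrite dotDr; have := hP _ _ hs st tw wh; lra.
have Pb : P b.
  (* A step around the supremum [s1], starting from a point of [P] just left of it, reaches [w]; as
     [w] cannot exceed [s1], it must equal [b]. *)
  have supP : has_sup P by split; [exists a|exists b => s []].
  set s1 := sup P.
  have s1b : s1 <= b by apply: ge_sup; [exists a|move=> s []].
  have as1 : a <= s1 by apply: ub_le_sup => //; case: supP.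
  have [|h h0 hP] := step s1; first by rewrite as1.
  have [s Ps hs] := sup_adherent h0 supP.
  have ss1 : s <= s1 by apply: ub_le_sup => //; case: supP.
  have h2 : 0 < h / 2 by rewrite divr_gt0.
  pose w := Num.min b (s1 + h / 2).
  have wb : w <= b by rewrite ge_min lexx.
  have s1w : s1 <= w by rewrite le_min s1b lerDl ltW.
  have Pw : P w.
    apply: (hP s w) => //.
    by rewrite gt_min; apply/orP; right; lra.
  have ws1 : w <= s1 by apply: ub_le_sup => //; case: supP.
  have -> // : b = w.
  apply/le_anti; rewrite wb andbT; move: ws1; rewrite ge_min => /orP[bs|]; last lra.
  exact: le_trans s1w.
have [_ _ [L Lf [Lm Lx]]] := Pb.
have Ld : \sum_(uv <- L) (uv.2 - uv.1) < d.
  rewrite -lte_fin; apply: le_lt_trans Ud; apply: (le_trans Lm).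
  apply: le_measure; rewrite ?inE //.
    by apply: measurableI => //; exact: measurable_itv.
have := dP _ Lf Ld; have := enorm_ge0 p; nra.
Qed.

End absolute_continuity.

(** * Concatenation of trajectories *)

#[local] Instance lebesgue_ae_filter (R : realType) :
  Filter (nbhs (almost_everywhere (@lebesgue_measure R))).
Proof. exact: (ae_filter_ringOfSetsType lebesgue_measure). Qed.

Section translation.
Context (R : realType) (d : R).

Definition translation (t : R) : measurableTypeR R := t + d.

Lemma measurable_translation : measurable_fun [set: measurableTypeR R] translation.
Proof. by apply: measurable_funD => //; exact: measurable_cst. Qed.

(** Both measures give half-open intervals their length, which determines Lebesgue measure. *)
Lemma lebesgue_measure_translation (A : set R) : measurable A ->
  pushforward lebesgue_measure translation A = lebesgue_measure A.
Proof.
move=> mA; apply/esym/lebesgue_measure_unique => //=.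
  exact: measurable_translation.
move=> _ _ [[a b]] _ <-.
rewrite /pushforward (_ : _ @^-1` _ = `](a - d), (b - d)]%classic); last first.
  by apply/seteqP; split=> t /=; rewrite !in_itv /= /translation; lra.
rewrite !lebesgue_measure_itv /= !lte_fin ltrD2r.
by case: ifP => // _; congr EFin; ring.
Qed.

Lemma ae_translation (P : R -> Prop) : {ae lebesgue_measure, forall t : R, P t} ->
  {ae lebesgue_measure, forall t : R, P (t + d)}.
Proof.
move=> [B [mB B0 PB]]; exists (translation @^-1` B); split.
- by rewrite -[X in measurable X]setTI; exact: measurable_translation.
- by rewrite -B0 -[RHS]lebesgue_measure_translation.
- by move=> t /= nP; exact: PB.
Qed.

End translation.

Section trajectories.
Context (R : realType) (N : nat) (M : R) (H : 'rV[R]_N -> 'rV[R]_N -> R).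
Implicit Types (x y : R -> 'rV[R]_N) (a b c d s t : R) (v z : 'rV[R]_N).

Lemma derivable_translation x d t : derivable x (t + d) 1 ->
  derivable (fun s => x (s + d)) t 1 /\
  derive1 (fun s => x (s + d)) t = derive1 x (t + d).
Proof.
have E :
    (fun h => h^-1 *: (((fun s => x (s + d)) \o shift t) (h *: 1) - x (t + d))) =
    (fun h => h^-1 *: ((x \o shift (t + d)) (h *: 1) - x (t + d))).
  by apply/funext => h; rewrite /= addrA.
by rewrite !derive1E /derivable /derive E.
Qed.

Lemma derivable_line z v a t : derivable (fun s => z + (s - a) *: v) t 1 /\
  derive1 (fun s => z + (s - a) *: v) t = v.
Proof.
suff E : h^-1 *: (((fun s => z + (s - a) *: v) \o shift t) (h *: 1)
      - (z + (t - a) *: v))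
    @[h --> 0^'] --> v.
  by split; [apply/cvg_ex; exists v|rewrite derive1E; exact/cvg_lim].
apply: cvg_near_cst; near=> h; apply/eqP.
have h0 : h != 0 by near: h; exact: nbhs_dnbhs_neq.
rewrite /= opprD addrACA subrr add0r -scalerBl scalerA scaler1.
by rewrite (_ : h + t - a - (t - a) = h) ?mulVf ?scale1r //; ring.
Unshelve. all: by end_near. Qed.

Lemma near_eq_velocity x y t : (\forall s \near t, x s = y s) ->
  derivable x t 1 /\ velocity_set H (x t) (derive1 x t) ->
  derivable y t 1 /\ velocity_set H (y t) (derive1 y t).
Proof.
move=> xy [dx vx]; split; first exact: near_eq_derivable dx.
by rewrite derive1E -(near_eq_derive _ xy) -derive1E -(nbhs_singleton xy).
Qed.

(* Lipschitz arcs rather than absolutely continuous ones, as only the former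
   are stable under concatenation by a mere triangle inequality. *)
Definition trajectory_on a b x :=
  (forall s t, a <= s -> s <= t -> t <= b -> enorm (x t - x s) <= M * (t - s)) /\
  {ae lebesgue_measure, forall t : R, a < t < b ->
    derivable x t 1 /\ velocity_set H (x t) (derive1 x t)}.

Lemma ae_neq (a : R) : {ae lebesgue_measure, forall t : R, t != a}.
Proof.
exists [set a]; split; [exact: measurable_set1|exact: lebesgue_measure_set1|].
by move=> t /= /negP; rewrite negbK => /eqP.
Qed.

(** Differentiability is local, so at every time other than [c] the inclusion is inherited from one
    of the pieces; across [c] the Lipschitz bounds add up. *)
Lemma trajectory_on_concat a b c x y : a <= c -> c <= b -> x c = y c ->
  trajectory_on a c x -> trajectory_on c b y ->
  trajectory_on a b (fun t => if t < c then x t else y t).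
Proof.
move=> ac cb xyc [xL xF] [yL yF]; split.
  move=> s t as_ st tb; case: ltP => tc; case: ltP => sc.
  - exact: xL (ltW tc).
  - by have := lt_le_trans tc sc; rewrite ltNge st.
  - have -> : y t - x s = (y t - y c) + (x c - x s) by rewrite -xyc addrA subrK.
    apply: (le_trans (enormD _ _)).
    by have := yL c t (lexx _) tc tb; have := xL s c as_ (ltW sc) (lexx _); lra.
  - exact: yL.
apply: filterS3 xF yF (ae_neq c) => t xt yt tc /andP[at_ tb].
pose z t := if t < c then x t else y t.
rewrite -/z -/(z t); have [lt_tc|] := ltP t c.
  apply: (@near_eq_velocity x z t _ (xt _)); last by rewrite at_.
  near=> s; rewrite /z ifT //; near: s; exact: lt_nbhsl.
rewrite le_eqVlt eq_sym (negbTE tc) /= => ct.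
apply: (@near_eq_velocity y z t _ (yt _)); last by rewrite ct.
near=> s; rewrite /z ltNge ltW //; near: s; exact: lt_nbhsr.
Unshelve. all: by end_near. Qed.

Lemma trajectory_on_translation a b d x : trajectory_on (a + d) (b + d) x ->
  trajectory_on a b (fun t => x (t + d)).
Proof.
move=> [xL xF]; split=> [s t as_ st tb|].
  by rewrite (_ : t - s = (t + d) - (s + d)); [apply: xL; rewrite lerD2r|ring].
apply: filterS (ae_translation d xF) => t; rewrite !ltrD2r => xt /xt[dx vx].
by have [dy ->] := derivable_translation dx.
Qed.

Lemma trajectory_on_line a b z v : enorm v <= M ->
  (forall s, a <= s <= b -> velocity_set H (z + (s - a) *: v) v) ->
  trajectory_on a b (fun s => z + (s - a) *: v).
Proof.
move=> vM vF; split=> [s t as_ st tb|].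
  have -> : z + (t - a) *: v - (z + (s - a) *: v) = (t - s) *: v.
    by rewrite opprD addrACA subrr add0r -scalerBl; congr (_ *: _); ring.
  by rewrite enormZ ger0_norm ?subr_ge0 // mulrC ler_wpM2r // subr_ge0.
apply: aeW => t /andP[at_ tb]; have [dx ->] := derivable_line z v a t.
by split=> //; apply: vF; rewrite !ltW.
Qed.

(** The inclusion on the half-line is the countable intersection of those on []0, n[], with time 0
    discarded as a null set. *)
Lemma trajectory_on_trajectory x :
  0 <= M -> (forall b, 0 <= b -> trajectory_on 0 b x) ->
  trajectory H x.
Proof.
move=> M0 xT; split=> [a b a0 ab e e0|].
  have [xL _] := xT b (le_trans a0 ab).
  exists (e / (M + 1)); first by rewrite divr_gt0 // ltr_wpDl.
  move=> n u v uv _; rewrite ltr_pdivlMr ?ltr_wpDl // => /(le_lt_trans _); apply.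
  rewrite mulr_suml ler_sum // => i _; have [au uvi vb] := uv i.
  apply: le_trans (xL _ _ (le_trans a0 au) uvi vb) _.
  by rewrite (mulrDr (v i - u i)) mulr1 mulrC lerDl subr_ge0.
have xn n : {ae lebesgue_measure, forall t : R, 0 < t < n%:R ->
    derivable x t 1 /\ velocity_set H (x t) (derive1 x t)}.
  by have [] := xT n%:R (ler0n _ _).
apply: filterS2 (ae_foralln xn) (ae_neq 0) => t xt t0 t_ge0.
apply: (xt (Num.truncn t).+1); rewrite lt_neqAle eq_sym t0 t_ge0 /=.
exact: truncnS_gt.
Qed.

End trajectories.

(** * Difference quotients of small oscillation *)

Lemma powR_le_near0 (R : realType) (B beta e : R) : 0 <= B -> 0 < beta -> 0 < e ->
  exists2 d, 0 < d & forall a, 0 <= a -> a <= d -> B * a `^ beta <= e.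
Proof.
move=> B0 beta0 e0; have B1 : 0 < B + 1 by rewrite ltr_wpDl.
have eB : 0 < e / (B + 1) by rewrite divr_gt0.
exists ((e / (B + 1)) `^ beta^-1); first exact: powR_gt0.
move=> a a0 ad; apply: (@le_trans _ _ (B * (e / (B + 1)))).
  rewrite ler_wpM2l //; have := ge0_ler_powR (ltW beta0) _ _ ad.
  rewrite -powRrM mulVf ?gt_eqF // powRr1 ?(ltW eB) //.
  by apply; rewrite nnegrE // powR_ge0.
by rewrite mulrA ler_pdivrMr // mulrC ler_pM2l // lerDl.
Qed.

Section holder_derivative.
Context (R : realType) (N : nat) (x : R -> 'rV[R]_N) (T A beta : R).
Implicit Types (s t : R).

Definition slope s t := (t - s)^-1 *: (x t - x s).

Lemma slopeC s t : slope s t = slope t s.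
Proof.
by rewrite /slope -(opprB s t) -(opprB (x s)) invrN scaleNr scalerN opprK.
Qed.

Context (T_gt0 : 0 < T) (A_ge0 : 0 <= A) (beta_gt0 : 0 < beta).
Context (slope_osc : forall t1 t2 s1 s2, 0 <= t1 -> t1 <= s1 -> s1 < s2 ->
  s2 <= t2 -> t2 <= T -> t2 - t1 <= 2 * (s2 - s1) ->
  enorm (slope s1 s2 - slope t1 t2) <= A * (t2 - t1) `^ beta).

Let half := (2^-1 : R) `^ beta.

Let half_lt1 : half < 1.
Proof.
have := powR1 R => /(congr1 (@^~ beta)) <-.
apply: gt0_ltr_powR => //; rewrite ?nnegrE //.
by rewrite invf_lt1 // ltr1n.
Qed.

(** Sum of the geometric series with first term [A] and ratio [half], the factor gained in
    [slope_osc] by halving the length. *)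
Definition slope_constant := A / (1 - half).

Lemma slope_constant_ge : A <= slope_constant.
Proof.
rewrite /slope_constant ler_pdivlMr ?subr_gt0 // ler_piMr //.
by rewrite lerBlDr lerDl powR_ge0.
Qed.

Lemma slope_constant_ge0 : 0 <= slope_constant.
Proof. exact: le_trans slope_constant_ge. Qed.

(* Halve [[t1, t2]] around [[s1, s2]] until the lengths are comparable; the
   errors form a geometric series. *)
Lemma slope_nested t1 t2 s1 s2 : 0 <= t1 -> t1 <= s1 -> s1 < s2 ->
  s2 <= t2 -> t2 <= T ->
  enorm (slope s1 s2 - slope t1 t2) <= slope_constant * (t2 - t1) `^ beta.
Proof.
move=> t10 ts s12 st t2T.
have l0 : 0 < s2 - s1 by rewrite subr_gt0.
have [n] : exists n, t2 - t1 <= 2 ^+ n.+1 * (s2 - s1).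
  exists (Num.truncn ((t2 - t1) / (s2 - s1))).
  rewrite -ler_pdivrMr // (le_trans (ltW (truncnS_gt _))) //.
  by rewrite -natrX ler_nat ltnW // ltn_expl.
elim: n t1 t2 t10 ts st t2T => [|n IH] t1 t2 t10 ts st t2T hn.
  apply: le_trans (slope_osc t10 ts s12 st t2T hn) _.
  by rewrite ler_wpM2r ?powR_ge0 ?slope_constant_ge.
have [hl|hl] := leP (t2 - t1) (2 * (s2 - s1)).
  apply: le_trans (slope_osc t10 ts s12 st t2T hl) _.
  by rewrite ler_wpM2r ?powR_ge0 ?slope_constant_ge.
set h := t2 - t1 in hn hl *.
have h0 : 0 < h by apply: lt_trans hl; rewrite mulr_gt0.
(* [u1] is the leftmost left end for which an interval of length [h / 2] starts no earlier than [t1]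
   and still covers [s2]; it precedes [s1] because [2 * (s2 - s1) < h]. *)
pose u1 := Num.max t1 (s2 - h / 2); pose u2 := u1 + h / 2.
have tu : t1 <= u1 by rewrite le_max lexx.
have us : u1 <= s1 by rewrite ge_max ts /=; lra.
have su : s2 <= u2 by rewrite /u2 -lerBlDr le_max lexx orbT.
have ut : u2 <= t2.
  by rewrite /u2 -lerBrDr ge_max; apply/andP; split; rewrite /h; lra.
have uh : u2 - u1 = h / 2 by rewrite /u2 addrAC subrr add0r.
have {}IH := IH u1 u2 (le_trans t10 tu) us su (le_trans ut t2T).
have osc : enorm (slope u1 u2 - slope t1 t2) <= A * h `^ beta.
  apply: slope_osc => //; first by lra.
  by rewrite uh /h; lra.
apply: le_trans (enormB_trans (slope u1 u2) _ _) _.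
have IH' : enorm (slope s1 s2 - slope u1 u2) <= slope_constant * (h / 2) `^ beta.
  by rewrite -uh; apply: IH; rewrite uh; move: hn; rewrite exprS; lra.
rewrite powRM ?(ltW h0) ?invr_ge0 // -/half in IH'.
have AE : slope_constant * (1 - half) = A by rewrite divfK // gt_eqF // subr_gt0.
have hb : 0 <= h `^ beta by exact: powR_ge0.
move: IH' osc; rewrite -AE; lra.
Qed.

(** Both slopes are compared with the one over the window from [t - d] to [t + d], cut to
    [[0, T]]. *)
Lemma slope_close t s s' d : 0 <= t <= T -> 0 <= s <= T -> 0 <= s' <= T ->
  s != t -> s' != t -> `|s - t| <= d -> `|s' - t| <= d ->
  enorm (slope t s - slope t s') <= 2 * slope_constant * (2 * d) `^ beta.
Proof.
move=> /andP[t0 tT].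
have d0 u : u != t -> `|u - t| <= d -> 0 < d.
  by move=> ut; apply: lt_le_trans; rewrite normr_gt0 subr_eq0.
pose a := Num.max 0 (t - d); pose b := Num.min T (t + d).
have ab : b - a <= 2 * d.
  have : b <= t + d by rewrite ge_min lexx orbT.
  have : t - d <= a by rewrite le_max lexx orbT.
  lra.
have near_ab u : 0 <= u <= T -> u != t -> `|u - t| <= d ->
    enorm (slope t u - slope a b) <= slope_constant * (2 * d) `^ beta.
  move=> /andP[u0 uT] ut ud; have dd := d0 _ ut ud.
  move: ud; rewrite ler_norml => /andP[ud1 ud2].
  have a0 : 0 <= a by rewrite le_max lexx.
  have bT : b <= T by rewrite ge_min lexx.
  have au : a <= u by rewrite ge_max u0 /=; lra.
  have at_ : a <= t by rewrite ge_max t0 /=; lra.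
  have ub : u <= b by rewrite le_min uT /=; lra.
  have tb : t <= b by rewrite le_min tT /=; lra.
  apply: (@le_trans _ _ (slope_constant * (b - a) `^ beta)); last first.
    rewrite ler_wpM2l ?slope_constant_ge0 //.
    by apply: (ge0_ler_powR (ltW beta_gt0)) => //; rewrite nnegrE; lra.
  have [tu|ut'] := ltP t u; first exact: slope_nested.
  by rewrite slopeC; apply: slope_nested => //; rewrite lt_neqAle ut.
move=> sT s'T st s't sd s'd; have := near_ab _ sT st sd.
have := near_ab _ s'T s't s'd; rewrite enormBC.
have := enormB_trans (slope a b) (slope t s) (slope t s'); lra.
Qed.

Let punctured t : set_system R := within `[0, T] t^'.

Let punctured_proper t : 0 <= t <= T -> ProperFilter (punctured t).
Proof.
move=> /andP[t0 tT]; split; last exact: within_filter.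
move=> /nbhs_ballP[d /= d0 dP].
(* With [e <= T / 2], at least one of [t + e] and [t - e] stays in [[0, T]], even when [t] is an
   endpoint. *)
pose e := Num.min (d / 2) (T / 2).
have e0 : 0 < e by rewrite lt_min !divr_gt0.
have ed : e <= d / 2 by rewrite ge_min lexx.
have eT : e <= T / 2 by rewrite ge_min lexx orbT.
have [te|te] := leP (t + e) T.
  apply: (dP (t + e)) => /=.
  - by rewrite -ball_normE /= opprD addrA subrr add0r normrN gtr0_norm //; lra.
  - by rewrite -subr_eq0 addrAC subrr add0r gt_eqF.
  - by rewrite in_itv /= te andbT; lra.
apply: (dP (t - e)) => /=.
- by rewrite -ball_normE /= opprB addrC subrK gtr0_norm //; lra.
- by rewrite -subr_eq0 addrAC subrr add0r oppr_eq0 gt_eqF.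
- by rewrite in_itv /=; apply/andP; split; lra.
Qed.

Let near_punctured t d : 0 < d ->
  \forall s \near punctured t, [/\ 0 <= s <= T, s != t & `|s - t| <= d].
Proof.
move=> d0; apply/nbhs_ballP; exists d => //= s; rewrite -ball_normE /= => sd st.
by rewrite in_itv /= => sT; split=> //; rewrite distrC ltW.
Qed.

Definition slope_limit t : 'rV[R]_N := lim (slope t s @[s --> within `[0, T] t^']).

Lemma slope_cvg t : 0 <= t <= T -> slope t s @[s --> punctured t] --> slope_limit t.
Proof.
move=> tT; have PF := punctured_proper tT.
apply/cauchy_cvgP/cauchy_exP => e e0.
have B0 : 0 <= 2 * slope_constant * 2 `^ beta.
  by rewrite mulr_ge0 ?powR_ge0 // mulr_ge0 // slope_constant_ge0.
have [d d0 dP] := powR_le_near0 B0 beta_gt0 (divr_gt0 e0 (ltr0n R 2)).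
have near_d := near_punctured t d0.
have [s0 [s0T s0t s0d]] := filter_ex near_d.
exists (slope t s0); apply: filterS near_d => s [sT st sd].
rewrite -ball_normE /=; apply: le_lt_trans (norm_le_enorm _) _.
apply: le_lt_trans (slope_close tT s0T sT s0t st s0d sd) _.
rewrite powRM ?(ltW d0) // mulrA; apply: le_lt_trans (dP d (ltW d0) (lexx d)) _.
lra.
Qed.

(** Let [s'] tend to [t] in [slope_close], with [d] equal to the distance from [s] to [t]. *)
Lemma slope_limit_close t s : 0 <= t <= T -> 0 <= s <= T -> s != t ->
  enorm (slope t s - slope_limit t) <= 2 * slope_constant * (2 * `|s - t|) `^ beta.
Proof.
move=> tT sT st; have PF := punctured_proper tT.
have cl : enorm (slope t s - slope t s') @[s' --> punctured t] -->
    enorm (slope t s - slope_limit t).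
  apply: continuous_cvg; first exact: continuous_enorm.
  by apply: cvgB; [exact: cvg_cst|exact: slope_cvg].
apply: (cvgr_to_le cl).
have st0 : 0 < `|s - t| by rewrite normr_gt0 subr_eq0.
by apply: filterS (near_punctured t st0) => s' [s'T s't s'd]; exact: slope_close.
Qed.

Lemma holder_derivative : exists dx : R -> 'rV[R]_N,
  [/\ forall t, 0 <= t <= T -> is_derivative_within `[0, T] x t (dx t),
      {within `[0, T], continuous dx} &
      forall t1 t2, 0 <= t1 <= T -> 0 <= t2 <= T ->
        enorm (dx t2 - dx t1)
          <= 4 * slope_constant * 2 `^ beta * `|t2 - t1| `^ beta].
Proof.
have holder t1 t2 : 0 <= t1 <= T -> 0 <= t2 <= T ->
    enorm (slope_limit t2 - slope_limit t1)
      <= 4 * slope_constant * 2 `^ beta * `|t2 - t1| `^ beta.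
  move=> t1T t2T; have [->|t12] := eqVneq t2 t1.
    rewrite subrr enorm0 mulr_ge0 ?powR_ge0 // mulr_ge0 ?powR_ge0 // mulr_ge0 //.
    exact: slope_constant_ge0.
  (* The limits at [t1] and [t2] are both close to the slope between them, which is symmetric by
     [slopeC]. *)
  have c1 := slope_limit_close t1T t2T t12.
  have := slope_limit_close t2T t1T; rewrite eq_sym t12 slopeC => /(_ isT) c2.
  have := enormB_trans (slope t1 t2) (slope_limit t2) (slope_limit t1).
  rewrite (enormBC (slope_limit t2) (slope t1 t2)).
  have d0 : 0 <= `|t2 - t1| by exact: normr_ge0.
  move: c1 c2; rewrite (distrC t1) (powRM beta (ler0n R 2) d0).
  move: (enorm _) (enorm _) (enorm _) => e1 e2 e3 c1 c2 c3.
  apply: (le_trans c3); apply: le_trans (lerD c2 c1) _.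
  by rewrite le_eqVlt; apply/orP; left; apply/eqP; ring.
exists slope_limit; split=> //; first by move=> t tT; exact: slope_cvg.
apply/subspace_continuousP => t; rewrite /= in_itv => tT.
apply/(@cvgrPdist_le _ _ _ (within `[0, T] (nbhs t))) => e e0.
have B0 : 0 <= 4 * slope_constant * 2 `^ beta.
  by rewrite mulr_ge0 ?powR_ge0 // mulr_ge0 // slope_constant_ge0.
have [d d0 dP] := powR_le_near0 B0 beta_gt0 e0.
near=> s; apply: le_trans (norm_le_enorm _) _.
have sT : 0 <= s <= T.
  have : `[0, T]%classic s by near: s; exact: withinT.
  by rewrite /= in_itv.
apply: le_trans (holder _ _ sT tT) _; apply: dP; first exact: normr_ge0.
near: s; apply/nbhs_ballP; exists d => //= s; rewrite -ball_normE /=.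
by move=> /ltW.
Unshelve. all: by end_near. Qed.

End holder_derivative.

(** * Extremal trajectories *)

Section extremal_trajectories.
Context (R : realType) (N : nat) (C0 r Rup alpha : R).
Context (N_gt0 : (0 < N)%N) (C0_gt0 : 0 < C0) (r_gt0 : 0 < r) (r_lt_Rup : r < Rup).
Context (alpha_gt0 : 0 < alpha).
Context (H : 'rV[R]_N -> 'rV[R]_N -> R).
Context (SA : standing_assumptions C0 r Rup alpha H).
Context (x : R -> 'rV[R]_N) (traj_x : trajectory H x).
Implicit Types (p q v z : 'rV[R]_N) (a b c s t : R).

Let Rup_gt0 : 0 < Rup. Proof. exact: lt_trans r_lt_Rup. Qed.

Lemma trajectory_dot_le p s t c : 0 <= s -> s <= t -> 0 <= c ->
  (forall u v, s <= u <= t -> velocity_set H (x u) v -> dot p v <= c) ->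
  dot p (x t - x s) <= c * (t - s).
Proof.
move=> s0 st c0 Hc; apply: dot_increment_le_off_null => //.
  exact: traj_x.1.
apply: filterS traj_x.2 => u xu sut; have [|dx vx] := xu.
  by case/andP: sut => su _; exact: le_trans su.
by split=> //; exact: Hc vx.
Qed.

(** Test [trajectory_dot_le] in the direction of the increment itself. *)
Lemma trajectory_lipschitz s t : 0 <= s -> s <= t ->
  enorm (x t - x s) <= Rup * (t - s).
Proof.
move=> s0 st; have [->|xts] := eqVneq (x t - x s) 0.
  by rewrite enorm0 mulr_ge0 ?subr_ge0 // ltW.
have := @trajectory_dot_le (x t - x s) s t (Rup * enorm (x t - x s)) s0 st.
rewrite -enorm_sqr mulrAC expr2 ler_pM2r ?enorm_gt0 //; apply.
  by rewrite mulr_ge0 ?enorm_ge0 // ltW.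
move=> u v _ /(velocity_enorm_le r_gt0 r_lt_Rup SA) vR.
by apply: le_trans (dot_le _ _) _; rewrite mulrC ler_wpM2r ?enorm_ge0.
Qed.

Lemma trajectory_on_trajectory0 a b : 0 <= a -> trajectory_on Rup H a b x.
Proof.
move=> a0; split=> [s t as_ st _|].
  exact: trajectory_lipschitz (le_trans a0 as_) st.
by apply: filterS traj_x.2 => t xt /andP[at_ _]; apply/xt/(le_trans a0)/ltW.
Qed.

Lemma small_velocity z v : enorm v <= r -> velocity_set H z v.
Proof.
move=> vr; apply/(velocityP r_gt0 SA N_gt0) => q.
apply: le_trans (hamiltonian_ge SA z q); apply: le_trans (dot_le _ _) _.
by rewrite mulrC ler_wpM2r ?enorm_ge0.
Qed.

Context (K : set 'rV[R]_N) (T : R).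
Context (Kx0 : K (x 0)) (extremal_x : extremal H K T x).

(* Arriving at [x T] ahead of time leaves room to reach any nearby point with
   the speed [r], which is allowed everywhere. *)
Lemma extremal_segment_time t1 t2 tau v : 0 <= t1 -> t1 <= t2 -> t2 <= T ->
  0 < tau -> x t2 = x t1 + tau *: v ->
  (forall s, 0 <= s <= tau -> velocity_set H (x t1 + s *: v) v) ->
  t2 - t1 <= tau.
Proof.
move=> t10 t12 t2T tau0 xt2 Fv; rewrite leNgt; apply/negP => tau_lt.
have [_ []] := extremal_x.
pose d := t2 - t1 - tau; have d0 : 0 < d by rewrite subr_gt0.
(* The division by [N] puts the sup-norm ball inside the Euclidean ball of radius [r * d], which is
   within reach during the saved time [d]. *)
have rho0 : 0 < r * d / N%:R by rewrite divr_gt0 ?mulr_gt0 ?ltr0n.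
apply/nbhs_ballP; exists (r * d / N%:R) => //= y; rewrite -ball_normE /= => xTy.
pose e := d^-1 *: (y - x T).
have er : enorm e <= r.
  rewrite enormZ ger0_norm ?invr_ge0 ?(ltW d0) // mulrC ler_pdivrMr //.
  rewrite enormBC (le_trans (enorm_le_norm _)) //.
  by rewrite -ler_pdivlMl ?ltr0n // mulrC ltW.
have vR : enorm v <= Rup.
  apply: (velocity_enorm_le r_gt0 r_lt_Rup SA (Fv 0 _)).
  by rewrite lexx ltW.
(* The competitor [z] follows [x] up to [t1], takes the segment to [x t2], follows [x] ahead of
   schedule by [d] until it meets [x T] at time [T - d], and spends the remaining time going
   straight to [y]. *)
pose line1 s := x t1 + (s - t1) *: v.
pose line2 s := x T + (s - (T - d)) *: e.
pose z3 s := if s < T - d then x (s + d) else line2 s.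
pose z2 s := if s < t1 + tau then line1 s else z3 s.
pose z s := if s < t1 then x s else z2 s.
have Td : t1 + tau <= T - d by rewrite /d; lra.
have z_traj : trajectory H z.
  apply: (@trajectory_on_trajectory _ _ Rup) => [|b b0]; first exact: ltW.
  (* The horizon is enlarged to contain all switching times and restricted to [b] afterwards. *)
  have bb : trajectory_on Rup H 0 (Num.max b (T - d)) z.
    apply: trajectory_on_concat => //.
    - by rewrite le_max; apply/orP; right; lra.
    - rewrite /z2 ltrDl tau0 /line1 subrr scale0r addr0 //.
    - exact: trajectory_on_trajectory0.
    apply: (@trajectory_on_concat _ _ _ _ _ _ (t1 + tau)) => //.
    - by rewrite lerDl ltW.
    - by rewrite le_max Td orbT.
    - rewrite /line1 /z3 addrAC subrr add0r -xt2; case: ltP => Td'.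
        by congr x; rewrite /d; ring.
      rewrite /line2; have -> : t1 + tau - (T - d) = 0 by lra.
      by rewrite scale0r addr0; congr x; move: Td'; rewrite /d; lra.
    - apply: trajectory_on_line => // s /andP[h1 h2]; apply: Fv; lra.
    apply: (@trajectory_on_concat _ _ _ _ _ _ (T - d)) => //.
    - by rewrite le_max lexx orbT.
    - by rewrite /line2 subrK subrr scale0r addr0.
    - by apply/trajectory_on_translation/trajectory_on_trajectory0; lra.
    apply: trajectory_on_line => [|s _]; last exact: small_velocity.
    exact: le_trans (ltW r_lt_Rup).
  have [zL zF] := bb; split=> [s t s0 st tb|].
    by apply: zL => //; rewrite le_max tb.
  apply: filterS zF => t zt /andP[t0 tb]; apply: zt.
  by rewrite t0 lt_max tb.
exists z.
  split=> //; rewrite /z; case: ltP => // t1_le0.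
  have t1E : t1 = 0 by lra.
  by rewrite /z2 /line1 t1E add0r tau0 subrr scale0r addr0.
rewrite /z /z2 /z3 !ifF; last 3 first.
- by apply/negbTE; rewrite -leNgt; lra.
- by apply/negbTE; rewrite -leNgt; rewrite /d; lra.
- by apply/negbTE; rewrite -leNgt; lra.
rewrite /line2 (_ : T - (T - d) = d); last by ring.
by rewrite /e scalerA divff ?gt_eqF // scale1r addrC subrK.
Qed.

(** The bound [enorm q <= H z q / r] makes the Hoelder error relative. It is written as a square
    because quadratic strict convexity will turn it into a distance of order [kappa]. *)
Lemma hamiltonian_frozen z y q h kappa : 0 <= h -> enorm (y - z) <= Rup * h ->
  kappa = Num.sqrt (C0 / r) * (Rup * h) `^ alpha ->
  `|H y q - H z q| <= kappa ^+ 2 * H z q.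
Proof.
move=> h0 yz ->; apply: le_trans (SA_holder SA y z q) _.
have Rh0 : 0 <= Rup * h by rewrite mulr_ge0 // ltW.
have C0r : 0 <= C0 / r by rewrite divr_ge0 // ltW.
rewrite exprMn sqr_sqrtr // -powR_mulrn ?powR_ge0 // -powRrM.
have hol : enorm (y - z) `^ (2 * alpha) <= (Rup * h) `^ (alpha * 2%:R).
  rewrite (mulrC alpha); apply: ge0_ler_powR => //.
  - by rewrite mulr_ge0 // ltW.
  - by rewrite nnegrE enorm_ge0.
have qH : enorm q <= H z q / r.
  by rewrite ler_pdivlMr // mulrC; exact: hamiltonian_ge SA z q.
apply: (@le_trans _ _ (C0 * (Rup * h) `^ (alpha * 2%:R) * (H z q / r))).
  apply: ler_pM => //; first by rewrite mulr_ge0 ?powR_ge0 // ltW.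
    exact: enorm_ge0.
  by rewrite ler_pM2l.
by rewrite le_eqVlt; apply/orP; left; apply/eqP; ring.
Qed.

(* With the coefficients frozen at [x t1], all velocities lie in the velocity
   set dilated by [1 + kappa ^+ 2], whereas by minimality the chord does not
   lie in the one contracted by [1 - kappa ^+ 2]; strict convexity then keeps
   the averages over sizeable subintervals close to a single point [v0]. *)
Lemma averages_near_extreme_velocity t1 t2 kappa : 0 <= t1 -> t1 < t2 -> t2 <= T ->
  kappa = Num.sqrt (C0 / r) * (Rup * (t2 - t1)) `^ alpha -> kappa < 1 ->
  exists v0, forall s1 s2, t1 <= s1 -> s1 < s2 -> s2 <= t2 ->
    t2 - t1 <= 2 * (s2 - s1) ->
    enorm ((s2 - s1)^-1 *: (x s2 - x s1) - (1 + kappa ^+ 2) *: v0)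
      <= 6 * Rup * kappa.
Proof.
move=> t10 t12 t2T kE k1; set h := t2 - t1 in kE *.
have h0 : 0 < h by rewrite subr_gt0.
have k0 : 0 <= kappa by rewrite kE mulr_ge0 ?sqrtr_ge0 ?powR_ge0.
have k2 : kappa ^+ 2 < 1 by rewrite expr_lt1.
have k20 : 0 <= kappa ^+ 2 by exact: sqr_ge0.
have xR u : t1 <= u <= t2 -> enorm (x u - x t1) <= Rup * h.
  move=> /andP[u1 u2]; apply: le_trans (trajectory_lipschitz t10 u1) _.
  by rewrite ler_pM2l // lerD2r.
have frozen y q : enorm (y - x t1) <= Rup * h ->
    (1 - kappa ^+ 2) * H (x t1) q <= H y q <= (1 + kappa ^+ 2) * H (x t1) q.
  move=> /(hamiltonian_frozen q (ltW h0)) /(_ kE); rewrite ler_norml => /andP[? ?].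
  by apply/andP; split; lra.
have H0 q : 0 <= H (x t1) q by exact: (hamiltonian_ge0 r_gt0 SA).
have incr q u w : t1 <= u -> u <= w -> w <= t2 ->
    dot q (x w - x u) <= (1 + kappa ^+ 2) * H (x t1) q * (w - u).
  move=> u1 uw w2; apply: trajectory_dot_le => //; first exact: le_trans u1.
    by rewrite mulr_ge0 // addr_ge0.
  move=> s v /andP[us sw] /(velocity_dot_le SA) /(_ q) /le_trans; apply.
  have xs : enorm (x s - x t1) <= Rup * h.
    by apply: xR; rewrite (le_trans u1 us) (le_trans sw w2).
  by have /andP[] := frozen _ q xs.
set D := x t2 - x t1.
have DR : enorm D <= Rup * h by apply: xR; rewrite lexx ltW.
(* If the endpoints coincided, resting there for the time [h / 2] would beat the arc. *)
have D0 : D != 0.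
  apply/eqP => D0; have h2 : 0 < h / 2 by rewrite divr_gt0.
  have : t2 - t1 <= h / 2.
    apply: (@extremal_segment_time t1 t2 (h / 2) 0) => //; first exact: ltW.
      by rewrite scaler0 addr0; apply/eqP; rewrite -subr_eq0 -/D D0.
    by move=> s _; apply: small_velocity; rewrite enorm0 ltW.
  by rewrite -/h; lra.
have [g [p [g0 p1 pD DE FD]]] := velocity_gauge r_gt0 SA (x t1) D0.
have p0 : p != 0 by rewrite -enorm_eq0 p1 oner_eq0.
set v0 := grad (H (x t1)) p in DE.
(* Run in time [g / (1 - kappa ^+ 2)], the chord has a velocity in the contracted velocity set at
   [x t1], hence admissible all along the segment; extremality bounds [h] by that time. *)
have gh : h * (1 - kappa ^+ 2) <= g.
  have tau0 : 0 < g / (1 - kappa ^+ 2) by rewrite divr_gt0 // subr_gt0.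
  rewrite -ler_pdivlMr ?subr_gt0 //.
  apply: (@extremal_segment_time t1 t2 _ ((g / (1 - kappa ^+ 2))^-1 *: D)) => //.
  - exact: ltW.
  - by rewrite scalerA divff ?gt_eqF // scale1r addrC subrK.
  move=> s /andP[s0 st]; apply/(velocityP r_gt0 SA N_gt0) => q.
  have xs : enorm (x t1 + s *: ((g / (1 - kappa ^+ 2))^-1 *: D) - x t1) <= Rup * h.
    rewrite addrAC subrr add0r scalerA enormZ; apply: le_trans DR.
    have s_tau : 0 <= s / (g / (1 - kappa ^+ 2)) by rewrite divr_ge0 // ltW.
    apply: ler_piMl; first exact: enorm_ge0.
    by rewrite ger0_norm // ler_pdivrMr // mul1r.
  have /andP[+ _] := frozen _ q xs; apply: le_trans.
  have := velocity_dot_le SA FD q.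
  by rewrite !dotZr invf_div -mulrA ler_pM2l ?subr_gt0.
exists v0 => s1 s2 ts1 s12 s2t hs.
set l := s2 - s1 in hs *; have l0 : 0 < l by rewrite subr_gt0.
pose f := (l * (1 + kappa ^+ 2))^-1 *: (x s2 - x s1).
have lk0 : 0 < l * (1 + kappa ^+ 2) by rewrite mulr_gt0 // ltr_wpDr.
have Ff : velocity_set H (x t1) f.
  apply/(velocityP r_gt0 SA N_gt0) => q; rewrite dotZr ler_pdivrMl //.
  by apply: le_trans (incr q _ _ ts1 (ltW s12) s2t) _; rewrite -/l; lra.
have HpR : H (x t1) p <= Rup.
  by have := hamiltonian_le SA (x t1) p; rewrite p1 mulr1.
(* From the progress of the whole chord along [p], subtract the most that can be made before [s1]
   and after [s2]; the factor 4 comes from [h <= 2 * l]. *)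
have pf : H (x t1) p * (1 - 4 * kappa ^+ 2) <= dot p f.
  rewrite dotZr ler_pdivlMl //.
  have i1 := incr p _ _ (lexx t1) ts1 (le_trans (ltW s12) s2t).
  have i2 := incr p _ _ (le_trans ts1 (ltW s12)) s2t (lexx t2).
  have : dot p (x s2 - x s1)
      = g * H (x t1) p - dot p (x s1 - x t1) - dot p (x t2 - x s2).
    by rewrite -pD /D !dotBr; ring.
  move=> ->.
  have hg : h * (1 - kappa ^+ 2) * H (x t1) p <= g * H (x t1) p.
    by rewrite ler_wpM2r.
  have : 0 <= (2 * l - h + 2 * l * kappa ^+ 2) * (kappa ^+ 2 * H (x t1) p).
    by rewrite mulr_ge0 ?mulr_ge0 // addr_ge0 ?subr_ge0 // !mulr_ge0 // ltW.
  move: i1 i2 hg; rewrite /l /h; nra.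
have pv0 : dot p v0 = H (x t1) p by rewrite dotC; exact: (dot_grad_self SA).
have := velocity_strict_convexity r_gt0 r_lt_Rup SA p0 Ff.
rewrite p1 mulr1 -/v0 dotBr pv0 => sc.
(* The squared distance is at most [8 * Rup ^+ 2 * kappa ^+ 2], whence the 3; rescaling by
   [1 + kappa ^+ 2 <= 2] gives the final 6. *)
have fv : enorm (f - v0) <= 3 * Rup * kappa.
  rewrite -(@ler_pXn2r _ 2) ?nnegrE ?enorm_ge0 ?mulr_ge0 // ?(ltW Rup_gt0) //.
  have : (2 * Rup)^-1 * enorm (f - v0) ^+ 2 <= 4 * kappa ^+ 2 * Rup.
    apply: (@le_trans _ _ (4 * kappa ^+ 2 * H (x t1) p)); first by lra.
    by rewrite ler_wpM2l // mulr_ge0.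
  rewrite ler_pdivrMl ?mulr_gt0 // => /le_trans; apply.
  by have := sqr_ge0 (Rup * kappa); nra.
have -> : l^-1 *: (x s2 - x s1) = (1 + kappa ^+ 2) *: f.
  by rewrite scalerA invfM mulrCA divff ?mulr1 // gt_eqF // ltr_wpDr.
rewrite -scalerBr enormZ ger0_norm ?addr_ge0 //.
have := enorm_ge0 (f - v0); nra.
Qed.

Lemma average_le s1 s2 : 0 <= s1 -> s1 < s2 ->
  enorm ((s2 - s1)^-1 *: (x s2 - x s1)) <= Rup.
Proof.
move=> s10 s12; have l0 : 0 < s2 - s1 by rewrite subr_gt0.
rewrite enormZ ger0_norm ?invr_ge0 ?(ltW l0) // ler_pdivrMl // mulrC.
exact: trajectory_lipschitz s10 (ltW s12).
Qed.

Lemma average_oscillation_bounded t1 t2 s1 s2 :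
  0 <= t1 -> t1 <= s1 -> s1 < s2 -> s2 <= t2 ->
  enorm ((s2 - s1)^-1 *: (x s2 - x s1) - (t2 - t1)^-1 *: (x t2 - x t1)) <= 2 * Rup.
Proof.
move=> t10 ts s12 st; have t12 := le_lt_trans ts (lt_le_trans s12 st).
apply: le_trans (enormD _ _) _; rewrite enormN.
by have := average_le t10 t12; have := average_le (le_trans t10 ts) s12; lra.
Qed.

(** For [kappa < 1] both averages are close to the same point, since [[t1, t2]] is itself an
    admissible subinterval; for [kappa >= 1] the trivial bound is already smaller. *)
Lemma average_oscillation_alpha t1 t2 s1 s2 :
  0 <= t1 -> t1 <= s1 -> s1 < s2 -> s2 <= t2 -> t2 <= T ->
  t2 - t1 <= 2 * (s2 - s1) ->
  enorm ((s2 - s1)^-1 *: (x s2 - x s1) - (t2 - t1)^-1 *: (x t2 - x t1))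
    <= 12 * Rup * (Num.sqrt (C0 / r) * (Rup * (t2 - t1)) `^ alpha).
Proof.
move=> t10 ts s12 st t2T hs; have t12 := le_lt_trans ts (lt_le_trans s12 st).
set kappa := Num.sqrt _ * _; have [k1|k1] := ltP kappa 1.
  have [v0 v0P] := averages_near_extreme_velocity t10 t12 t2T (erefl kappa) k1.
  have := v0P s1 s2 ts s12 st hs.
  have := v0P t1 t2 (lexx _) t12 (lexx _); rewrite mulr_natl mulr2n.
  rewrite lerDl subr_ge0 => /(_ (ltW t12)).
  set A := (t2 - t1)^-1 *: _; set B := (s2 - s1)^-1 *: _; set V := _ *: v0 => AV BV.
  by have := enormB_trans V B A; rewrite (enormBC V A); lra.
apply: le_trans (average_oscillation_bounded t10 ts s12 st) _.
by have := Rup_gt0; nra.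
Qed.

Definition oscillation_constant :=
  2 * Rup + 12 * Rup * (Num.sqrt (C0 / r) * Rup `^ alpha).

(** For lengths up to 1, the power [alpha] is below the power [alpha / 2]; for longer intervals the
    trivial bound [2 * Rup] suffices. Each case uses one term of the constant. *)
Lemma average_oscillation t1 t2 s1 s2 :
  0 <= t1 -> t1 <= s1 -> s1 < s2 -> s2 <= t2 -> t2 <= T ->
  t2 - t1 <= 2 * (s2 - s1) ->
  enorm ((s2 - s1)^-1 *: (x s2 - x s1) - (t2 - t1)^-1 *: (x t2 - x t1))
    <= oscillation_constant * (t2 - t1) `^ (alpha / 2).
Proof.
move=> t10 ts s12 st t2T hs.
have t12 := le_lt_trans ts (lt_le_trans s12 st).
have bdd := average_oscillation_bounded t10 ts s12 st.
have osc := average_oscillation_alpha t10 ts s12 st t2T hs.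
have h0 : 0 < t2 - t1 by rewrite subr_gt0.
move: (t2 - t1) (enorm _) h0 bdd osc => h e h0 bdd.
rewrite powRM ?(ltW h0) ?(ltW Rup_gt0) // (mulrA (Num.sqrt _)) (mulrA (12 * Rup)).
rewrite /oscillation_constant; set D := 12 * Rup * _ => osc.
have D0 : 0 <= D.
  by rewrite /D mulr_ge0 // mulr_ge0 ?sqrtr_ge0 ?powR_ge0 // ltW.
have p0 : 0 <= h `^ (alpha / 2) by exact: powR_ge0.
have R0 : 0 <= 2 * Rup by rewrite mulr_ge0 // ltW.
rewrite mulrDl; have [h1|h1] := leP h 1.
  apply: le_trans osc _; apply: (@le_trans _ _ (D * h `^ (alpha / 2))).
    rewrite ler_wpM2l //; apply: ger_powR; first by rewrite h0.
    by rewrite ler_pdivrMr // ler_peMr ?(ltW alpha_gt0) // ler1n.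
  by rewrite lerDr mulr_ge0.
apply: le_trans bdd _; apply: (@le_trans _ _ (2 * Rup * h `^ (alpha / 2))).
  rewrite ler_peMr // -[leLHS](powRr0 h); apply: ler_powR; first exact: ltW.
  by rewrite divr_ge0 // ltW.
by rewrite lerDl mulr_ge0.
Qed.

End extremal_trajectories.

Theorem theorem4p1 (R : realType) (N : nat) (C0 r Rup alpha : R)
    (N_gt0 : (0 < N)%N) (C0_gt0 : 0 < C0) (r_gt0 : 0 < r) (r_lt_Rup : r < Rup)
    (alpha_gt0 : 0 < alpha) (alpha_lt : alpha < 1 / 2) :
  exists2 C : R, 0 < C &
    forall H : 'rV[R]_N -> 'rV[R]_N -> R,
      continuous (fun z : 'rV[R]_N * 'rV[R]_N => H z.1 z.2) ->
      standing_assumptions C0 r Rup alpha H ->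
    forall (K : set 'rV[R]_N) (T : R) (x : R -> 'rV[R]_N),
      closed K -> 0 < T ->
      trajectory H x -> K (x 0) -> extremal H K T x ->
    exists dx : R -> 'rV[R]_N,
      [/\ forall t, 0 <= t <= T -> is_derivative_within `[0, T] x t (dx t),
          {within `[0, T], continuous dx} &
          forall t1 t2, 0 <= t1 <= T -> 0 <= t2 <= T ->
            enorm (dx t2 - dx t1) <= C * `|t2 - t1| `^ (alpha / 2)].
Proof.
pose A := oscillation_constant C0 r Rup alpha.
have Rup_gt0 := lt_trans r_gt0 r_lt_Rup.
have A_gt0 : 0 < A.
  rewrite ltr_wpDr ?mulr_gt0 // mulr_ge0 ?mulr_ge0 ?sqrtr_ge0 ?powR_ge0 //.
  exact: ltW.
have beta_gt0 : 0 < alpha / 2 by rewrite divr_gt0.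
(* This is the constant of [holder_derivative] for the exponent [alpha / 2]; it is fixed before [H],
   [K], [T] and the arc are introduced. *)
exists (4 * slope_constant A (alpha / 2) * 2 `^ (alpha / 2)).
  rewrite mulr_gt0 ?powR_gt0 // mulr_gt0 //.
  exact: lt_le_trans (slope_constant_ge (ltW A_gt0) beta_gt0).
move=> H _ SA K T x _ T_gt0 traj_x Kx0 extr_x.
apply: (holder_derivative T_gt0 (ltW A_gt0) beta_gt0) => t1 t2 s1 s2.
exact: (average_oscillation N_gt0 C0_gt0 r_gt0 r_lt_Rup alpha_gt0 SA traj_x Kx0
  extr_x).
Qed.
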